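(* For any $p\ge1$, and any $(u,z)\in[0,t]\times\mathbb{R}_+$ with $u>v_1$ such that $P(\lambda(u)>z)>0$, $$\mathbb{E}\Big(\frac{1_{(0,\lambda(u)]}(z)}{|D^{\overline N}_{u,z}X_t|^{p}}\Big)<\infty$$ (the quotient being $0$ where $1_{(0,\lambda(u)]}(z)=0$).
   Context: Fix $T>0$, $t\in(0,T]$, constants $\lambda_0,\alpha,\beta>0$ with $\alpha/\beta<1$, $\mu\in\mathbb{R}$, $\sigma>0$. Let $\overline N$ be a Poisson random measure on $\mathbb{R}\times[0,\infty)$ with mean measure $dt\,dz$, $\tilde{\overline N}(dt,dz)=\overline N(dt,dz)-dt\,dz$, and $W$ a Brownian motion independent of $\overline N$. The Hawkes intensity is $$\lambda(s)=\varphi_s(\overline N|_{(-\infty,s)}):=\lambda_0+\int_{[0,s)}\int_{\mathbb{R}_+}\alpha e^{-\beta(s-r)}1_{(0,\lambda(r)]}(z)\,\overline N(dr,dz),\qquad s\in[0,T].$$ The measurable function $J:[0,T]\to\mathbb{R}$ satisfies: $\int_0^T(e^{J_s}-1)^{2p}ds<\infty$ for every $p\ge1$; and $J$ is nonnegative, strictly increasing, with $J_0=0$. The log-price is $$X_t=\Big(\mu-\tfrac12\sigma^2\Big)t+\sigma W_t+\int_0^t(J_s-e^{J_s}+1)\lambda(s)\,ds+\int_0^t\int_{\mathbb{R}_+}J_s1_{(0,\lambda(s)]}(z)\,\tilde{\overline N}(ds,dz).$$ With $\epsilon_{(u,z)}$ the Dirac measure at $(u,z)$, for $s>u$, $$D^{\overline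 N}_{u,z}\lambda(s)=\varphi_s(\overline N|_{(-\infty,s)}+\epsilon_{(u,z)})-\varphi_s(\overline N|_{(-\infty,s)}),$$ $$N_{(u,z)}(ds)=\overline N\Big(ds\times\big(\varphi_s(\overline N|_{(-\infty,s)}+\epsilon_{(u,z)})\wedge\varphi_s(\overline N|_{(-\infty,s)}),\ \varphi_s(\overline N|_{(-\infty,s)}+\epsilon_{(u,z)})\vee\varphi_s(\overline N|_{(-\infty,s)})\big]\Big),$$ and the Malliavin derivative of $X_t$ in the direction of $\overline N$ is $$D^{\overline N}_{u,z}X_t=J_u1_{(0,\lambda(u)]}(z)+\int_u^tJ_s\operatorname{sign}(D^{\overline N}_{u,z}\lambda(s))\,N_{(u,z)}(ds)-\int_u^t(e^{J_s}-1)D^{\overline N}_{u,z}\lambda(s)\,ds .$$ For $0\le v\le t$, $$F(v)=J_v-\int_v^t(e^{J_s}-1)\alpha e^{-\beta(s-v)}\,ds,\qquad G(v)=e^{J_v}-1-\beta\int_v^t(e^{J_s}-1)\,ds .$$ $v_0$ denotes the unique root of the strictly increasing function $G$ on $[0,t]$, and $v_1\in[v_0,t]$ is a point such that $F$ is increasing and positive on $[v_1,t]$. *)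

(* Defs.v *)
From HB Require Import structures.
From mathcomp Require Import all_boot all_order all_algebra.
From mathcomp Require Import all_classical all_reals all_analysis.
From mathcomp Require Import measurable_realfun.
Set Implicit Arguments.
Unset Strict Implicit.
Unset Printing Implicit Defensive.
Import Order.TTheory GRing.Theory Num.Theory.
Import numFieldNormedType.Exports.
Local Open Scope classical_set_scope.
Local Open Scope ring_scope.

Section independence.
Context (R : realType) (d : measure_display) (Omega : measurableType d)
  (P : probability Omega R).

(* The product rule over subfamilies is the case [A i = setT] for the omitted
   indices. *)
Definition independent_family (d' : measure_display) (S : measurableType d')
    (n : nat) (X : 'I_n -> Omega -> S) : Prop :=
  forall A : 'I_n -> set S, (forall i, measurable (A i)) ->
    P (\bigcap_(i in [set: 'I_n]) X i @^-1` A i) =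
    (\prod_(i < n) P (X i @^-1` A i))%E.

Definition independent_sigma (F G : set (set Omega)) : Prop :=
  forall A B, F A -> G B -> P (A `&` B) = (P A * P B)%E.

End independence.

Section poisson_and_brownian.
Context (R : realType) (d : measure_display) (Omega : measurableType d)
  (P : probability Omega R).

(* A random measure on R x [0, +oo) is represented as one on R x R whose mean
   does not charge R x (-oo, 0). *)
Definition mean_measure (B : set (R * R)) : \bar R :=
  (@lebesgue_measure R \x @lebesgue_measure R)%E
    (B `&` ([set: R] `*` `[0, +oo[)).

(* The law is tested through [poisson_prob] and not [poisson_pmf]: the former is
   the Dirac mass at 0 when the rate vanishes, the latter is not. *)
Definition is_poisson_random_measure (nu : set (R * R) -> \bar R)
    (N : Omega -> {measure set (R * R) -> \bar R}) : Prop :=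
  [/\ forall B, measurable B -> measurable_fun [set: Omega] (fun w => N w B),
      forall w B, measurable B ->
        N w B = +oo%E \/ exists k : nat, N w B = (k%:R)%:E,
      forall B, measurable B -> (nu B < +oo)%E -> forall k : nat,
        P [set w | N w B = (k%:R)%:E] =
        poisson_prob (fine (nu B)) 0%N [set k],
      forall B, measurable B -> nu B = +oo%E ->
        {ae P, forall w, N w B = +oo%E}
    & forall (n : nat) (B : 'I_n -> set (R * R)),
        (forall i, measurable (B i)) -> trivIset [set: 'I_n] B ->
        independent_family P (fun i w => N w (B i)) ].

Definition is_brownian_motion (W : R -> Omega -> R) : Prop :=
  [/\ forall s, 0 <= s -> measurable_fun [set: Omega] (W s),
      {ae P, forall w, W 0 w = 0},
      {ae P, forall w, {within `[0, +oo[, continuous (W ^~ w)}},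
      forall r s, 0 <= r -> r < s -> forall A : set R, measurable A ->
        P [set w | A (W s w - W r w)] = normal_prob 0 (Num.sqrt (s - r)) A
    & forall (n : nat) (s : nat -> R), 0 <= s 0%N ->
        (forall i, s i <= s i.+1) ->
        independent_family P
          (fun (i : 'I_n) w => W (s i.+1) w - W (s i) w) ].

Definition sigma_process (W : R -> Omega -> R) : set (set Omega) :=
  <<s [set E | exists s (A : set R),
         [/\ 0 <= s, measurable A & E = W s @^-1` A]] >>.

Definition sigma_random_measure
    (N : Omega -> {measure set (R * R) -> \bar R}) : set (set Omega) :=
  <<s [set E | exists (B : set (R * R)) (A : set (\bar R)),
         [/\ measurable B, measurable A & E = (fun w => N w B) @^-1` A]] >>.

End poisson_and_brownian.

Section hawkes.
Context (R : realType).
Local Notation config := {measure set (R * R) -> \bar R}.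

Definition past (s : R) : set (R * R) := `]-oo, s[ `*` [set: R].

Lemma measurable_past (s : R) : measurable (past s).
Proof. by apply: measurableX. Qed.

Definition restr_past (m : config) (s : R) : config :=
  mrestr m (measurable_past s).

Definition add_point (m : config) (q : R * R) : config :=
  measure_add m (dirac q).

(* The implicit equation defining the Hawkes intensity functional at the
   configuration [m]. It is an equation in the extended reals with real-valued
   [phi], so it contains the finiteness of the intensity on [0, T]. *)
Definition hawkes_equation (lambda0 alpha beta T : R)
    (phi : R -> config -> R) (m : config) : Prop :=
  forall s, 0 <= s <= T ->
    ((phi s (restr_past m s))%:E =
     lambda0%:E +
     \int[m]_(q in `[0%R, s[ `*` `[0%R, +oo[)
       (alpha * expR (- beta * (s - q.1)) *
        \1_(`]0, phi q.1 (restr_past m q.1)]) q.2)%:E)%E.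

Section processes.
Context (d : measure_display) (Omega : measurableType d)
  (P : probability Omega R) (N : Omega -> config).

(* [phi] need not solve the equation at every configuration, as the solution
   explodes at some of them; it does almost surely at N and at N with one
   point added, which are the configurations met below. *)
Definition is_hawkes_functional (lambda0 alpha beta T : R)
    (phi : R -> config -> R) : Prop :=
  [/\ {ae P, forall w, hawkes_equation lambda0 alpha beta T phi (N w)},
      forall u z, 0 <= u <= T -> 0 <= z ->
        {ae P, forall w,
           hawkes_equation lambda0 alpha beta T phi (add_point (N w) (u, z))}
    & forall s, 0 <= s <= T ->
        measurable_fun [set: Omega] (fun w => phi s (restr_past (N w) s)) ].

Variables (phi : R -> config -> R) (J : R -> R).

Definition intensity (s : R) (w : Omega) : R := phi s (restr_past (N w) s).

Definition intensity_plus (u z s : R) (w : Omega) : R :=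
  phi s (add_point (restr_past (N w) s) (u, z)).

Definition D_intensity (u z s : R) (w : Omega) : R :=
  intensity_plus u z s w - intensity s w.

Definition N_between (u z : R) (w : Omega) (A : set R) : \bar R :=
  N w [set q | A q.1 /\
    q.2 \in `]Num.min (intensity_plus u z q.1 w) (intensity q.1 w),
              Num.max (intensity_plus u z q.1 w) (intensity q.1 w)]].

(* The integral against the compensated measure is the difference of the
   integrals against N and against its mean. *)
Definition log_price (mu sigma : R) (W : R -> Omega -> R) (t : R) (w : Omega) :
    \bar R :=
  (((mu - sigma ^+ 2 / 2) * t + sigma * W t w)%:E
   + \int[@lebesgue_measure R]_(s in `[0%R, t])
       ((J s - expR (J s) + 1) * intensity s w)%:E
   + (\int[N w]_(q in `[0%R, t] `*` `[0%R, +oo[)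
        (J q.1 * \1_(`]0, intensity q.1 w]) q.2)%:E
      - \int[(@lebesgue_measure R \x @lebesgue_measure R)]_(q in
          `[0%R, t] `*` `[0%R, +oo[)
          (J q.1 * \1_(`]0, intensity q.1 w]) q.2)%:E))%E.

Definition D_log_price (t u z : R) (w : Omega) : \bar R :=
  ((J u * \1_(`]0, intensity u w]) z)%:E
   + \int[N_between u z w]_(s in `]u, t])
       (J s * Num.sg (D_intensity u z s w))%:E
   - \int[@lebesgue_measure R]_(s in `]u, t])
       ((expR (J s) - 1) * D_intensity u z s w)%:E)%E.

End processes.

Definition F_fun (J : R -> R) (alpha beta t v : R) : R :=
  J v - \int[@lebesgue_measure R]_(s in `[v, t])
          ((expR (J s) - 1) * alpha * expR (- beta * (s - v))).

Definition G_fun (J : R -> R) (beta t v : R) : R :=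
  expR (J v) - 1 -
  beta * \int[@lebesgue_measure R]_(s in `[v, t]) (expR (J s) - 1).

End hawkes.

(* Main.v *)
Require Import Defs.
From HB Require Import structures.
From mathcomp Require Import all_boot all_order all_algebra.
From mathcomp Require Import all_classical all_reals all_analysis.
From mathcomp Require Import measurable_realfun.
From mathcomp Require Import ring.
Set Implicit Arguments.
Unset Strict Implicit.
Unset Printing Implicit Defensive.
Import Order.TTheory GRing.Theory Num.Theory.
Import numFieldNormedType.Exports.
Local Open Scope classical_set_scope.
Local Open Scope ring_scope.

(** On the event [0 < z <= lambda(u)] the Malliavin derivative of the log-price is
almost surely bounded below by the positive constant [F(u)], so the expectation
is at most [F(u)^-p].

Fix an outcome for which the Hawkes equation holds for the configuration [m]
and for [m] with the point [(u, z)] added, and call [l] and [l'] the two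
intensity paths. They agree up to [u], and the added point is accepted. A Hawkes
process is self-exciting, so [l <= l'] afterwards ([added_point_increases]). Hence
the derivative of the intensity is positive and decomposes into clusters
([added_point_increment]): for [s > u],
  [l' s - l s = alpha e^(-beta (s - u)) + sum_v alpha e^(-beta (s - v))],
where [v] runs over the times before [s] of the points of [m] between [l] and
[l'], that is, of those accepted because of the added point. Inserting this in
the definition of the derivative of the log-price and exchanging integrals
(Tonelli), the added point contributes [F u] and each induced point contributes
  [J v - int_v^t (e^(J s) - 1) alpha e^(-beta (s - v)) ds = F v],
so that the derivative is [F u + sum_v F v >= F u]
([compensator_le], [F_le_D_log_price]), since [F] is positive after [v1].

The argument is deterministic and holds for an arbitrary measure [m] in place of
a locally finite set of points: sums over points are integrals against [m], and
the induction over the successive points in the proof that [l <= l'] is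
replaced by continuity from above of a finite measure ([set0_of_mass_before]).
What remains is measurability. The intensity paths are measurable because
they are, up to explicit factors, monotone ([measurable_hawkes_path]); the final
expectation is estimated without knowing that its integrand is measurable
([integral_ae_le_cst]). *)

(** * Integrals of arbitrary functions and set functions *)

Section integration.
Context d (T : measurableType d) (R : realType).
Local Open Scope ereal_scope.
Import HBNNSimple.

(** The integral of a nonnegative function is a supremum over simple functions
below it, so monotonicity and positive scaling hold for functions that are not
known to be measurable. This is what makes the measurability of Hawkes paths
provable: it has to be read off an integral whose integrand involves the path
itself. *)
Lemma ge0_integral_scale_le (m : {measure set T -> \bar R}) (D D' : set T)
    (f g : T -> \bar R) (a : R) :
  (0 < a)%R -> D `<=` D' -> (forall x, D x -> 0 <= f x) ->
  (forall x, D' x -> 0 <= g x) -> (forall x, D x -> a%:E * f x <= g x) ->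
  a%:E * \int[m]_(x in D) f x <= \int[m]_(x in D') g x.
Proof.
move=> a0 DD' f0 g0 fg; rewrite muleC -lee_pdivlMr//.
rewrite !ge0_integralE//; apply: ge_ereal_sup => _ [h /= hf <-].
rewrite lee_pdivlMr// muleC -sintegralrM; apply: ereal_sup_ubound => /=.
have a0' : (0 <= a)%R by exact: ltW.
exists (mul_nnsfun (cst_nnsfun T (NngNum a0')) h) => //= x.
have := hf x; rewrite !patchE; case: ifPn => [/set_mem Dx|_] hx; last first.
  have -> : h x = 0%R.
    by apply/eqP; rewrite eq_le fun_ge0 andbT -lee_fin.
  by rewrite mulr0; case: ifPn => // /set_mem /g0.
rewrite mem_set; last exact: DD'.
apply: le_trans (fg _ Dx); rewrite EFinM; apply: lee_wpmul2l => //.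
Qed.

(** No measurability is asked of [f]: a simple function below [f] is almost surely
below [c], and only simple functions are integrated. The Malliavin derivative
is not known to be a measurable function of the random outcome. *)
Lemma integral_ae_le_cst (P : probability T R) (f : T -> \bar R) (c : R) :
  (0 <= c)%R -> (forall x, 0 <= f x) -> {ae P, forall x, f x <= c%:E} ->
  \int[P]_x f x <= c%:E.
Proof.
move=> c0 f0 fc; rewrite ge0_integralE//; apply: ge_ereal_sup => _ [h /= hf <-].
rewrite -integralT_nnsfun.
have -> : c%:E = \int[P]_x (cst c%:E x).
  by rewrite integral_cst//= probability_setT mule1.
apply: ae_ge0_le_integral => //.
- by move=> x _; rewrite lee_fin fun_ge0.
- by apply/measurable_EFinP; exact: measurable_funP.
- apply: filterS fc => x fx _; apply: le_trans fx.
  by have := hf x; rewrite patch_setT.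
Qed.

(** Stated for bare set functions, because [N_between] carries no measure
structure: outside (u, t] it involves values of the intensity functional that
no hypothesis controls. A level set of a simple function vanishing off [D] is
inside [D] unless its level is 0, and then it counts for 0. *)
Lemma eq_integral_set_function (m1 m2 : set T -> \bar R) (D : set T)
    (f1 f2 : T -> \bar R) :
  (forall A, measurable A -> A `<=` D -> m1 A = m2 A) ->
  (forall x, D x -> f1 x = f2 x) ->
  \int[m1]_(x in D) f1 x = \int[m2]_(x in D) f2 x.
Proof.
move=> m12 f12.
have -> : integral m1 D f1 = integral m1 D f2.
  rewrite /integral; suff -> : f1 \_ D = f2 \_ D by [].
  by apply/funext => x; rewrite !patchE; case: ifPn => // /set_mem /f12.
have sub h (g : {nnsfun T >-> R}) : (forall x, (g x)%:E <= (h \_ D) x) ->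
    sintegral m1 g = sintegral m2 g.
  move=> gh; apply: eq_fsbigr => r _.
  have [->|r0] := eqVneq r 0%R; first by rewrite !mul0e.
  congr (_ * _); apply: m12 => // x /= gx; apply: contrapT => Dx.
  have := gh x; rewrite patchE memNset// gx lee_fin => r_le0.
  by move: r0; rewrite -gx eq_le gx r_le0 -gx fun_ge0.
rewrite /integral funepos_restrict funeneg_restrict.
by congr (ereal_sup _ - ereal_sup _); rewrite eqEsubset; split => _ [g /= gh <-];
  exists g => //; rewrite (sub _ _ gh).
Qed.

Lemma integral_mrestr (m : {measure set T -> \bar R}) (S : set T)
    (mS : measurable S) (D : set T) (f : T -> \bar R) :
  measurable D -> S `<=` D ->
  (forall x, D x -> 0 <= f x) -> measurable_fun D f ->
  \int[mrestr m mS]_(x in D) f x = \int[m]_(x in S) f x.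
Proof.
move=> mD SD f0 mf; rewrite (@ge0_negligible_integral _ _ _ _ D (D `\` S))//.
- rewrite setDD setIidr//; apply: eq_measure_integral => A mA AS.
  by rewrite /= /mrestr setIidl.
- exact: measurableD.
- by rewrite /= /mrestr setDE -setIA setICl setI0 measure0.
Qed.

End integration.

(** Tonelli's theorem without sigma-finiteness of [m1]: only the part of the
configuration between two intensity paths is known to have finite mass. *)
Lemma tonelli_restricted d1 d2 (T1 : measurableType d1) (T2 : measurableType d2)
    (R : realType) (m1 : {measure set T1 -> \bar R})
    (m2 : {sigma_finite_measure set T2 -> \bar R}) (S : set T1)
    (f : T1 * T2 -> \bar R) :
  measurable S -> (m1 S < +oo)%E -> measurable_fun setT f ->
  (forall x, 0 <= f x)%E ->
  [/\ measurable_fun S (fun x => \int[m2]_y f (x, y))%E,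
      measurable_fun setT (fun y => \int[m1]_(x in S) f (x, y))%E &
      (\int[m2]_y \int[m1]_(x in S) f (x, y) =
       \int[m1]_(x in S) \int[m2]_y f (x, y))%E].
Proof.
move=> mS finS mf f0; pose m := mfrestr mS finS.
have mF : measurable_fun setT (fun x => \int[m2]_y f (x, y))%E.
  exact: (measurable_fun_fubini_tonelli_F (m2 := m2) f).
have restr y : (\int[m1]_(x in S) f (x, y) = \int[m]_x f (x, y))%E.
  by apply/esym/integral_mrestr => //; exact: measurableT_comp.
split; first exact: measurable_funS mF.
  under eq_fun do rewrite restr.
  exact: (measurable_fun_fubini_tonelli_G (m1 := m) f).
have -> : (\int[m2]_y \int[m1]_(x in S) f (x, y) =
    \int[m2]_y \int[m]_x f (x, y))%E.
  by apply: eq_integral => y _; exact: restr.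
rewrite -(fubini_tonelli (m1 := m) (m2 := m2))//.
by apply: integral_mrestr => // x _; exact: integral_ge0.
Qed.

(** * Paths of the Hawkes equation *)

Section strips.
Context (R : realType).
Implicit Types (D : set R) (f g l : R -> R).

(** The points with abscissa in [D] between the graphs of [f] and [g]: those
accepted by the thinning with rate [g] and rejected by that with rate [f]. *)
Definition strip D f g : set (R * R) :=
  [set q | D q.1 /\ f q.1 < q.2 <= g q.1].

Lemma measurable_strip D f g : measurable D ->
  measurable_fun D f -> measurable_fun D g -> measurable (strip D f g).
Proof.
move=> mD mf mg.
have mf' := (measurable_restrictT f mD).1 mf.
have mg' := (measurable_restrictT g mD).1 mg.
have -> : strip D f g = (D `*` [set: R]) `&`
    [set q | ((f \_ D) q.1 < q.2) && (q.2 <= (g \_ D) q.1)].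
  apply/seteqP; split => -[r z] /=.
    by move=> [Dr H]; rewrite !patchE mem_set.
  by move=> [[Dr _]]; rewrite !patchE mem_set.
apply: measurableI; first exact: measurableX.
have : measurable_fun [set: R * R]
    (fun q => ((f \_ D) q.1 < q.2) && ((q.2 <= (g \_ D) q.1))).
  apply: measurable_and.
    by apply: measurable_fun_ltr => //; exact: measurableT_comp.
  by apply: measurable_fun_ler => //; exact: measurableT_comp.
by move=> /(_ measurableT [set true]); rewrite setTI; apply.
Qed.

(** If [B] had points, the parts of [B] before [s], for [s] in [B] decreasing to
[inf B], would shrink to the empty set (the infimum itself cannot be in [B], which
has mass before each of its points), contradicting continuity from above of a
finite measure. *)
Lemma set0_of_mass_before (m : {measure set (R * R) -> \bar R})
    (S : set (R * R)) (B : set R) (u c : R) :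
  measurable S -> (m S < +oo)%E -> measurable B -> lbound B u -> 0 < c ->
  (forall s, B s ->
     (c%:E <= m (S `&` ((B `&` `]-oo, s[) `*` [set: R])))%E) ->
  B = set0.
Proof.
move=> mS finS mB Bu c0 massB; apply/seteqP; split => // s Bs; exfalso.
pose x := inf B.
have infB : has_inf B by split; [exists s|exists u].
have mE (b : R) : measurable (S `&` ((B `&` `]-oo, b[) `*` [set: R])).
  by apply: measurableI => //; apply: measurableX => //; exact: measurableI.
have xB y : B y -> x < y.
  move=> By; rewrite lt_neqAle; apply/andP; split; last first.
    exact: (ge_inf infB.2).
  apply/eqP => xy; have := massB _ By.
  rewrite (_ : _ `&` _ = set0) ?measure0 ?lee_fin ?leNgt ?c0//.
  apply/seteqP; split => // -[r z] [_ [[Br]]] /=; rewrite in_itv/= => ry _.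
  by have := ge_inf infB.2 Br; rewrite -/x xy leNgt ry.
pose F n := S `&` ((B `&` `]-oo, (x + n.+1%:R^-1)[) `*` [set: R]).
have capF : \bigcap_n F n = set0.
  apply/seteqP; split => // -[r z] H; exfalso.
  have Br : B r by have [_ [[]]] := H 0%N Logic.I.
  have [n] := ltr_add_invr (xB _ Br).
  rewrite ltNge => /negP; apply; apply: ltW.
  by have [_ [[_]]] := H n Logic.I; rewrite /= in_itv.
have cvF : m \o F @ \oo --> m (\bigcap_n F n).
  apply: nonincreasing_cvg_mu => //.
  - apply: le_lt_trans finS; apply: le_measure; rewrite ?inE//.
    + exact: mE.
    + by move=> ? [].
  - by move=> n; exact: mE.
  - by rewrite capF.
  - move=> n k nk; apply/subsetPset => -[r z] [Sr [[Br rk] _]].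
    split => //; split => //; split => //.
    move: rk; rewrite /= !in_itv/= => /lt_le_trans; apply.
    by rewrite lerD2l lef_pV2 ?posrE ?ltr0Sn// ler_nat.
move: cvF; rewrite capF measure0 => cvF.
have : (c%:E <= limn (m \o F))%E.
  apply: lime_ge; first by apply/cvg_ex; exists 0%E.
  near=> n => /=.
  have e0 : 0 < (n.+1%:R^-1 : R) by rewrite invr_gt0 ltr0Sn.
  have [y By yx] := inf_adherent e0 infB.
  apply: le_trans (massB _ By) _; apply: le_measure; rewrite ?inE; try exact: mE.
  move=> [r z] [Sr [[Br ry] _]]; split => //; split => //; split => //.
  by move: ry; rewrite /= !in_itv/= => /lt_trans; apply.
by rewrite (cvg_lim _ cvF)// lee_fin leNgt c0.
Unshelve. all: by end_near. Qed.

End strips.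

Section hawkes_paths.
Context (R : realType) (lambda0 alpha beta T : R).
Hypotheses (alpha0 : 0 < alpha) (beta0 : 0 < beta).
Implicit Types (m : {measure set (R * R) -> \bar R}) (l : R -> R).

Definition decay (s r : R) : R := alpha * expR (- beta * (s - r)).

Lemma decay_gt0 s r : 0 < decay s r.
Proof. by rewrite mulr_gt0// expR_gt0. Qed.

Lemma decay_le s r : r <= s -> decay s r <= alpha.
Proof.
move=> rs; rewrite -[leRHS]mulr1 ler_pM2l// -expR0 ler_expR mulNr oppr_le0.
by rewrite mulr_ge0 ?subr_ge0// ltW.
Qed.

Lemma decay_ge s r : s <= T -> 0 <= r -> decay T 0 <= decay s r.
Proof.
move=> sT r0; rewrite /decay ler_pM2l// ler_expR !mulNr lerN2 ler_pM2l//.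
by rewrite lerB.
Qed.

Lemma measurable_decay (s : R) (D : set (R * R)) :
  measurable_fun D (fun q => (decay s q.1)%:E).
Proof.
apply/measurable_EFinP/measurable_funM => //.
apply: measurableT_comp => //; apply: measurable_funM => //.
by apply: measurable_funB => //; apply: measurable_funTS.
Qed.

(** The equation behind [hawkes_equation], with the intensity path as its unknown
instead of the functional of the configuration, so that the paths of two
configurations can be compared. *)
Definition hawkes_path m l := forall s, 0 <= s <= T ->
  ((l s)%:E = lambda0%:E +
    \int[m]_(q in `[0%R, s[ `*` `[0%R, +oo[)
      (alpha * expR (- beta * (s - q.1)) * \1_(`]0, l q.1]) q.2)%:E)%E.

Lemma hawkes_path_strip m l s : hawkes_path m l -> 0 <= s <= T ->
  ((l s)%:E = lambda0%:E +
    \int[m]_(q in strip `[0%R, s[ (cst 0%R) l) (decay s q.1)%:E)%E.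
Proof.
move=> hl s0T; rewrite hl//; congr (_ + _)%E.
rewrite integral_mkcond [RHS]integral_mkcond; congr integral.
apply/funext => -[r z]; rewrite !patchE /decay indicE/=.
case: ifPn => [/set_mem [/= r0s z0]|nD]; case: ifPn => [/set_mem [/= r0s' rz]|nS] //.
- by rewrite mem_set ?mulr1//= in_itv.
- rewrite memNset ?mulr0//= in_itv/= => rz.
  by apply: (negP nS); apply/mem_set; split.
- exfalso; apply: (negP nD); apply/mem_set; split => //=.
  by rewrite in_itv/= andbT; case/andP : rz => /ltW.
Qed.

(** The path solves the equation pointwise, and nothing more is assumed of it. But
[expR (beta * s) * (l s - lambda0)] is the integral over times in [0, s) of a
nonnegative function that does not depend on [s], hence is nondecreasing in [s]
and thus measurable. *)
Lemma measurable_hawkes_path m l : hawkes_path m l ->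
  measurable_fun `[0, T] l.
Proof.
move=> hl.
have [T0|T0] := ltP T 0.
  by rewrite set_itv_ge ?bnd_simp -?ltNge//; exact: measurable_fun_set0.
(* Clamping to [0, T] makes the monotone function total. *)
pose cl s := Num.max 0 (Num.min s T).
have clP s : 0 <= cl s <= T.
  by rewrite le_max lexx/= ge_max T0/= ge_min lexx orbT.
have cl_nd s s' : s <= s' -> cl s <= cl s'.
  by move=> ss'; rewrite /cl le_max2// le_min2.
pose g s := expR (beta * cl s) * (l (cl s) - lambda0).
have g_nd : nondecreasing_fun g.
  move=> s s' ss'; rewrite /g.
  set a := cl s; set b := cl s'.
  have ab : a <= b by exact: cl_nd.
  have aP : 0 <= a <= T by exact: clP.
  have bP : 0 <= b <= T by exact: clP.
  have -> : expR (beta * b) = expR (beta * a) * expR (beta * (b - a)).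
    by rewrite -expRD; congr expR; ring.
  rewrite -mulrA ler_pM2l ?expR_gt0// mulrC -ler_pdivrMr ?expR_gt0// mulrC.
  have e (x : R) : ((x - lambda0)%:E = x%:E - lambda0%:E)%E by [].
  rewrite -lee_fin EFinM !e !hl// [X in (_ * X <= _)%E]addeAC subee// add0e.
  rewrite [leRHS]addeAC subee// add0e.
  apply: ge0_integral_scale_le.
  - by rewrite invr_gt0 expR_gt0.
  - move=> [r z] [/= r1 z1]; split => //=; move: r1; rewrite !in_itv/=.
    by move=> /andP[-> /lt_le_trans]; apply.
  - by move=> q _; rewrite lee_fin mulr_ge0// ltW// decay_gt0.
  - by move=> q _; rewrite lee_fin mulr_ge0// ltW// decay_gt0.
  - move=> q _; rewrite -EFinM lee_fin -expRN mulrA ler_wpM2r//.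
    rewrite mulrCA -expRD ler_pM2l// ler_expR le_eqVlt; apply/orP; left.
    by apply/eqP; ring.
apply: (@eq_measurable_fun _ _ _ _ _
    (fun s => lambda0 + expR (- beta * s) * g s)).
  move=> s /set_mem; rewrite /= in_itv/= => /andP[s0 sT].
  rewrite /g; have -> : cl s = s by rewrite /cl min_l// max_r.
  by rewrite mulrA -expRD mulNr addNr expR0 mul1r addrC subrK.
apply: measurable_funD => //; apply: measurable_funM.
  by apply: measurableT_comp => //; exact: measurable_funM.
exact: nondecreasing_measurable.
Qed.

Lemma measurable_hawkes_strip m l s : hawkes_path m l -> s <= T ->
  measurable (strip `[0, s[ (cst 0) l).
Proof.
move=> hl sT; apply: measurable_strip => //.
apply: measurable_funS (measurable_hawkes_path hl) => //.
by move=> r /=; rewrite !in_itv/= => /andP[-> /ltW /le_trans]; apply.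
Qed.

(** Each accepted point raises the intensity at [T] by at least [decay T 0], and
the intensity at [T] is finite. *)
Lemma hawkes_path_finite_strip m l : 0 <= T -> hawkes_path m l ->
  (m (strip `[0%R, T[ (cst 0%R) l) < +oo)%E.
Proof.
move=> T0 hl; set S := strip _ _ _.
have mS : measurable S by exact: (measurable_hawkes_strip hl).
have : ((decay T 0)%:E * m S <= (l T - lambda0)%:E)%E.
  rewrite EFinB (hawkes_path_strip hl) ?T0 ?lexx// addeAC subee// add0e.
  rewrite -integral_cst//; apply: ge0_le_integral => //.
  - by move=> q _; rewrite lee_fin ltW// decay_gt0.
  - exact: measurable_decay.
  - move=> [r z] [/=]; rewrite in_itv/= => /andP[r0 _] _.
    by rewrite lee_fin decay_ge.
rewrite muleC -lee_pdivlMr ?decay_gt0// => /le_lt_trans; apply.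
by rewrite ltry.
Qed.

End hawkes_paths.

(** * The effect of an added point on the intensity *)

Section added_point.
Context (R : realType) (lambda0 alpha beta T : R).
Hypotheses (alpha0 : 0 < alpha) (beta0 : 0 < beta).
Hypothesis lambda0_gt0 : 0 < lambda0.
Variables (m : {measure set (R * R) -> \bar R}) (l l' : R -> R) (u z : R).
Local Notation decay := (decay alpha beta).
Hypothesis hl : hawkes_path lambda0 alpha beta T m l.
Hypothesis hl' : hawkes_path lambda0 alpha beta T (add_point m (u, z)) l'.
Hypothesis u0 : 0 <= u.
Hypothesis zlu : 0 < z <= l u.
Hypothesis same_past : forall r, r <= u -> l' r = l r.

Lemma hawkes_path_gt0 r : 0 <= r <= T -> 0 < l r.
Proof.
move=> rT; rewrite -lte_fin (hawkes_path_strip hl)//.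
apply: lt_le_trans (leeDl _ _); rewrite ?lte_fin//.
by apply: integral_ge0 => q _; rewrite lee_fin ltW// decay_gt0.
Qed.

(** The equation for the path after a point has been added, rewritten as an
integral against the original configuration: the new point is accepted because
the two paths agree up to its time. *)
Lemma added_point_strip s : u < s <= T ->
  ((l' s)%:E = lambda0%:E + (decay s u)%:E +
    \int[m]_(q in strip `[0%R, s[ (cst 0%R) l') (decay s q.1)%:E)%E.
Proof.
move=> /andP[us sT]; have s0 : 0 <= s by rewrite (le_trans u0)// ltW.
have mS : measurable (strip `[0, s[ (cst 0) l').
  exact: measurable_hawkes_strip hl' sT.
rewrite (hawkes_path_strip hl') ?s0//.
rewrite ge0_integral_measure_add//; first last.
- exact: measurable_decay.
- by move=> q _; rewrite lee_fin ltW// decay_gt0.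
rewrite [X in (_ + (_ + X))%E](_ : _ = (decay s u)%:E); last first.
  rewrite integral_dirac//; last exact: measurable_decay.
  rewrite diracE mem_set ?mul1e//; split => /=.
    by rewrite in_itv/= u0.
  by rewrite same_past.
by set I := integral m _ _; rewrite addeA addeAC.
Qed.

(** A Hawkes process is monotone in its past. Let [B] be the set of times after
[u] at which the path with the extra point is strictly below the other. For [r]
in [B], the contribution at least [decay T 0] of the extra point is offset at
time [r], which takes points accepted by [l] but not by [l']. These have their
abscissas in [B], before [r], and each contributes at most [alpha]. So the mass
of [B] before each of its points is at least [alpha^-1 * decay T 0], and [B] is
empty. *)
Lemma added_point_increases s : u < s <= T -> l s <= l' s.
Proof.
move=> /[dup] usT /andP[us sT]; rewrite leNgt; apply/negP => l'l.
have T0 : 0 <= T by rewrite (le_trans u0)// (le_trans _ sT)// ltW.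
pose B := `]u, T] `&` [set r | l' r < l r].
suff B0 : B = set0.
  have : B s by split => //=; rewrite in_itv/= us.
  by rewrite B0.
have sub0T : `]u, T] `<=` `[0, T].
  move=> r /=; rewrite !in_itv/= => /andP[ur ->].
  by rewrite (le_trans u0)// ltW.
have ml := measurable_hawkes_path alpha0 hl.
have ml' := measurable_hawkes_path alpha0 hl'.
have mB : measurable B.
  have := measurable_fun_ltr (measurable_funS _ sub0T ml')
    (measurable_funS _ sub0T ml) => /(_ (measurable_itv _) (measurable_itv _)).
  by move=> /(_ (measurable_itv _) [set true]); apply.
pose S := strip `[0, T[ (cst 0) l.
have mS : measurable S by exact: measurable_hawkes_strip hl _.
have finS : (m S < +oo)%E by exact: hawkes_path_finite_strip hl.
apply: (@set0_of_mass_before _ m S B u (alpha^-1 * decay T 0)) => //.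
- by move=> r [/=]; rewrite in_itv/= => /andP[/ltW].
- by rewrite mulr_gt0 ?invr_gt0// decay_gt0.
move=> r [/=]; rewrite in_itv/= => /andP[ur rT] l'r.
have r0 : 0 <= r by rewrite (le_trans u0)// ltW.
set A := S `&` _.
have mA : measurable A.
  by apply: measurableI => //; apply: measurableX => //; exact: measurableI.
have mS' : measurable (strip `[0, r[ (cst 0) l').
  exact: measurable_hawkes_strip hl' rT.
have msr : measurable (strip `[0, r[ (cst 0) l).
  exact: measurable_hawkes_strip hl rT.
have dge0 q : (0 <= (decay r q.1 : R)%:E)%E.
  by rewrite lee_fin ltW// decay_gt0.
set I' := (\int[m]_(q in strip `[0%R, r[ (cst 0%R) l') (decay r q.1)%:E)%E.
have I'fin : I' \is a fin_num.
  rewrite ge0_fin_numE ?integral_ge0//.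
  apply: (@le_lt_trans _ _ (l' r)%:E); last by rewrite ltry.
  rewrite (added_point_strip (s := r)) ?ur// leeDr// -EFinD lee_fin.
  by rewrite addr_ge0 ?ltW// decay_gt0.
have : ((decay r u)%:E + I' < I' + alpha%:E * m A)%E.
  apply: (@lt_le_trans _ _
    (\int[m]_(q in strip `[0%R, r[ (cst 0%R) l) (decay r q.1)%:E)%E).
    rewrite -(@lteD2lE _ lambda0%:E)// -(hawkes_path_strip hl) ?r0// addeA.
    by rewrite -added_point_strip ?ur// lte_fin.
  apply: (@le_trans _ _ (\int[m]_(q in strip `[0%R, r[ (cst 0%R) l' `|`
      (A `\` strip `[0%R, r[ (cst 0%R) l')) (decay r q.1)%:E)%E).
    apply: ge0_subset_integral => //.
    - by apply: measurableU => //; exact: measurableD.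
    - exact: measurable_decay.
    (* A point accepted by [l] but not by [l'] comes after [u], since the paths
       agree before, and then at a time of [B]. *)
    - move=> [a b] [/= ar /andP[b0 bl]].
      have [bl'|bl'] := leP b (l' a); [left|right].
        by split => //=; rewrite b0.
      move: ar; rewrite in_itv/= => /andP[a0 ar].
      have ua : u < a.
        by rewrite ltNge; apply/negP => au; move: bl'; rewrite same_past// ltNge bl.
      split; last by move=> [_ /= /andP[_]]; rewrite leNgt bl'.
      split; first by split => /=; rewrite ?b0//= in_itv/= a0 (lt_le_trans ar).
      split => //; split; last by rewrite /= in_itv.
      split => /=; last exact: lt_le_trans bl.
      by rewrite in_itv/= ua (le_trans _ rT)// ltW.
  rewrite ge0_integral_setU//; first last.
  - by rewrite disj_set2E setDIK.
  - exact: measurable_decay.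
  - exact: measurableD.
  rewrite leeD2l//.
  apply: (@le_trans _ _ (\int[m]_(q in A) (decay r q.1)%:E)%E).
    apply: ge0_subset_integral => //; first exact: measurableD.
    exact: measurable_decay.
  rewrite -integral_cst//; apply: ge0_le_integral => //.
  - exact: measurable_decay.
  - move=> [a b] [_ [[_ /=]]]; rewrite in_itv/= => ar _.
    by rewrite lee_fin decay_le// ltW.
rewrite [ltLHS]addeC lteD2lE// => /ltW H.
rewrite EFinM lee_pdivrMl//; apply: le_trans H.
by rewrite lee_fin decay_ge.
Qed.

(** The cluster decomposition of the Malliavin derivative of the intensity: the
direct effect of the added point, plus the effects of the points accepted
because of it. *)
Lemma added_point_increment s : u < s <= T ->
  ((l' s)%:E = (l s)%:E + (decay s u)%:E +
    \int[m]_(q in strip `]u, s[ l l') (decay s q.1)%:E)%E.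
Proof.
move=> /[dup] usT /andP[us sT]; have s0 : 0 <= s by rewrite (le_trans u0)// ltW.
have sub0T : `]u, s[ `<=` `[0, T].
  move=> r /=; rewrite !in_itv/= => /andP[ur /ltW rs].
  by rewrite (le_trans rs)// (le_trans u0)// ltW.
have ml := measurable_funS (measurable_itv _) sub0T
  (measurable_hawkes_path alpha0 hl).
have ml' := measurable_funS (measurable_itv _) sub0T
  (measurable_hawkes_path alpha0 hl').
rewrite added_point_strip// (hawkes_path_strip hl) ?s0//.
set I := integral m _ _; set I' := integral m _ _; set I'' := integral m _ _.
suff -> : I = (I' + I'')%E.
  by rewrite addeA; congr (_ + _)%E; rewrite addeAC.
rewrite /I /I' /I'' {I I' I''}.
transitivity (\int[m]_(q in strip `[0%R, s[ (cst 0%R) l `|` strip `]u, s[ l l')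
    (decay s q.1)%:E)%E; last first.
  apply: ge0_integral_setU.
  - exact: measurable_hawkes_strip hl sT.
  - exact: measurable_strip.
  - exact: measurable_decay.
  - by move=> q _; rewrite lee_fin ltW// decay_gt0.
  - rewrite disj_set2E; apply/eqP/seteqP; split => // -[r y] /=.
    by move=> [[_ /= /andP[_ yl]] [_ /= /andP[]]]; rewrite ltNge yl.
congr (integral m); apply/seteqP; split => -[r y] /=.
  move=> [/= rs /andP[y0 yl']].
  have [yl|ly] := leP y (l r); [left|right]; split => //=; rewrite ?y0 ?ly//.
  move: rs; rewrite !in_itv/= => /andP[r0 ->]; rewrite andbT ltNge.
  by apply/negP => ru; move: yl'; rewrite same_past// leNgt ly.
move=> [|] [/= rs /andP[y0 yl]]; split => //=.
- rewrite y0/=; have [ru|ur] := leP r u; first by rewrite same_past.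
  apply: (le_trans yl); apply: added_point_increases; rewrite ur/=.
  by move: rs; rewrite in_itv/= => /andP[_ /ltW /le_trans]; apply.
- by move: rs; rewrite !in_itv/= => /andP[/ltW ur ->]; rewrite (le_trans u0).
- rewrite yl andbT (lt_trans _ y0)// hawkes_path_gt0//.
  by have := sub0T _ rs; rewrite /= in_itv.
Qed.

Lemma added_point_finite_strip v : u <= v <= T ->
  (m (strip `]u, v[ l l') < +oo)%E.
Proof.
move=> /andP[uv vT]; have T0 : 0 <= T by rewrite (le_trans u0)// (le_trans uv).
have fin' := hawkes_path_finite_strip alpha0 beta0 T0 hl'.
apply: le_lt_trans fin'; rewrite /add_point.
have sub : strip `]u, v[ l l' `<=` strip `[0, T[ (cst 0) l'.
  move=> [r y] [/=]; rewrite in_itv/= => /andP[ur rv] /andP[ly yl'].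
  have rT := lt_le_trans rv vT.
  have r0 : 0 <= r by rewrite (le_trans u0)// ltW.
  split => /=; first by rewrite in_itv/= r0.
  by rewrite yl' andbT (lt_trans _ ly)// hawkes_path_gt0// r0 ltW.
rewrite [leRHS]measure_addE; apply: le_trans (leeDl _ _) => //.
apply: le_measure; rewrite ?inE//; last exact: measurable_hawkes_strip hl' _.
have sub0T : `]u, v[ `<=` `[0, T].
  move=> r /=; rewrite !in_itv/= => /andP[ur /ltW rv].
  by rewrite (le_trans u0) ?(le_trans rv)// ltW.
apply: measurable_strip => //; apply: measurable_funS sub0T _ => //.
  exact: measurable_hawkes_path hl.
exact: measurable_hawkes_path hl'.
Qed.

End added_point.

(** * The compensator of the added cluster *)

Section compensator.
Context (R : realType) (alpha beta t : R) (J : R -> R).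
Hypotheses (alpha0 : 0 < alpha) (beta0 : 0 < beta).
Hypothesis mJ : measurable_fun `[0, t] J.
Hypothesis J_ge0 : forall s, 0 <= s <= t -> 0 <= J s.
Hypothesis J_nd : forall r s, 0 <= r -> r <= s -> s <= t -> J r <= J s.
Local Notation decay := (decay alpha beta).
Local Notation leb := (@lebesgue_measure R).
Local Notation F := (F_fun J alpha beta t).

Definition growth (s : R) : R := expR (J s) - 1.

Lemma growth_ge0 s : 0 <= s <= t -> 0 <= growth s.
Proof. by move=> st; rewrite subr_ge0 -expR0 ler_expR J_ge0. Qed.

Lemma measurable_growth : measurable_fun `[0, t] growth.
Proof. by apply: measurable_funB => //; exact: measurableT_comp. Qed.

Lemma sub_itv0t v : 0 <= v -> `]v, t] `<=` `[0, t].
Proof.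
by move=> v0 r /=; rewrite !in_itv/= => /andP[/ltW vr ->]; rewrite (le_trans v0).
Qed.

Lemma growth_decay_ge0 v r s : 0 <= v -> s \in `]v, t] ->
  0 <= growth s * decay s r.
Proof.
move=> v0 /(sub_itv0t v0) /=; rewrite in_itv/= => s0t.
by rewrite mulr_ge0 ?growth_ge0// ltW// decay_gt0.
Qed.

Lemma measurable_growth_decay v r : 0 <= v ->
  measurable_fun `]v, t] (fun s => growth s * decay s r).
Proof.
move=> v0; apply: measurable_funM.
  exact: measurable_funS (sub_itv0t v0) measurable_growth.
apply: measurable_funM => //; apply: measurableT_comp => //.
by apply: measurable_funM => //; apply: measurable_funB.
Qed.

Lemma compensator_fin_num v : 0 <= v <= t ->
  (\int[leb]_(s in `]v, t]) (growth s * decay s v)%:E)%E \is a fin_num.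
Proof.
move=> /andP[v0 vt]; have t0 := le_trans v0 vt.
rewrite ge0_fin_numE; last first.
  by apply: integral_ge0 => s /= vs; rewrite lee_fin (growth_decay_ge0 _ v0).
apply: (@le_lt_trans _ _ (\int[leb]_(s in `]v, t])
    (cst (growth t * alpha)%:E s))%E).
  apply: ge0_le_integral => //.
  - by move=> s /= vs; rewrite lee_fin (growth_decay_ge0 _ v0).
  - by apply/measurable_EFinP; exact: measurable_growth_decay.
  - move=> s /= vs; rewrite lee_fin.
    have /= := sub_itv0t v0 vs; rewrite in_itv/= => /andP[s0 st].
    move: vs; rewrite in_itv/= => /andP[vs _].
    rewrite ler_pM//.
    + by rewrite growth_ge0// s0.
    + by rewrite ltW// decay_gt0.
    + by rewrite lerB// ler_expR J_nd.
    + by rewrite decay_le// ltW.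
rewrite integral_cst//= lebesgue_measure_itv/= lte_fin.
by case: ifPn => _; rewrite ?mule0 ?ltry// -EFinM ltry.
Qed.

(** [J v - F v] is what an accepted point at time [v] adds to the compensator
through its own effect on the intensity. The real-valued integral in [F_fun] is
the extended one because [J] is bounded by [J t]. *)
Lemma compensatorE v : 0 <= v <= t ->
  (\int[leb]_(s in `]v, t]) (growth s * decay s v)%:E = (J v - F v)%:E)%E.
Proof.
move=> vt; rewrite /F_fun opprB addrC subrK /Rintegral.
rewrite -integral_itv_obnd_cbnd; last first.
  apply/measurable_EFinP.
  apply: eq_measurable_fun (measurable_growth_decay v _); last by case/andP: vt.
  by move=> s _; rewrite mulrA.
rewrite -[LHS]fineK ?compensator_fin_num//; congr (fine _)%:E.
by apply: eq_integral => s _; rewrite mulrA.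
Qed.

Variables (m : {measure set (R * R) -> \bar R}) (l l' : R -> R) (u : R).
Hypothesis u0t : 0 <= u <= t.
Hypothesis mS : measurable (strip `]u, t[ l l').
Hypothesis finS : (m (strip `]u, t[ l l') < +oo)%E.
Hypothesis increment : forall s, u < s <= t ->
  ((l' s)%:E = (l s)%:E + (decay s u)%:E +
    \int[m]_(q in strip `]u, s[ l l') (decay s q.1)%:E)%E.
Hypothesis F_ge0 : forall v, u < v <= t -> 0 <= F v.

Let u0 : 0 <= u. Proof. by case/andP: u0t. Qed.

Let strip_time q : strip `]u, t[ l l' q -> 0 <= q.1 <= t.
Proof.
move=> [/=]; rewrite in_itv/= => /andP[/ltW uq /ltW ->] _.
by rewrite (le_trans u0).
Qed.

Lemma measurable_strip_jumps :
  measurable_fun (strip `]u, t[ l l') (fun q => (J q.1)%:E).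
Proof.
apply/measurable_EFinP; apply: (@measurable_comp _ _ _ _ _ _ `[0, t]) => //.
- by move=> _ [q /strip_time qt <-] /=; rewrite in_itv.
- exact: measurable_funTS.
Qed.

Lemma strip_jumps_fin_num :
  (\int[m]_(q in strip `]u, t[ l l') (J q.1)%:E)%E \is a fin_num.
Proof.
rewrite ge0_fin_numE; last first.
  by apply: integral_ge0 => q /strip_time qt; rewrite lee_fin J_ge0.
apply: (@le_lt_trans _ _ (\int[m]_(q in strip `]u, t[ l l') (cst (J t)%:E q))%E).
  apply: ge0_le_integral => //.
  - by move=> q /strip_time qt; rewrite lee_fin J_ge0.
  - exact: measurable_strip_jumps.
  - by move=> q /strip_time /andP[q0 qt]; rewrite lee_fin J_nd.
rewrite integral_cst//; apply: lte_mul_pinfty => //.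
by rewrite lee_fin J_ge0// (le_trans u0)//=; case/andP: u0t.
Qed.

(** Substituting the cluster decomposition and exchanging the integrals, the
compensator splits into [J u - F u] for the added point and [J v - F v] for each
point accepted because of it at a time [v]. The latter is at most [J v] since
[F] is nonnegative after [u]. *)
Lemma compensator_le :
  (\int[leb]_(s in `]u, t]) (growth s * (l' s - l s))%:E <=
   (J u - F u)%:E + \int[m]_(q in strip `]u, t[ l l') (J q.1)%:E)%E.
Proof.
pose g := growth \_ `]u, t].
have g0 s : 0 <= g s.
  rewrite /g patchE; case: ifPn => // /set_mem /(sub_itv0t u0) /=.
  by rewrite in_itv/=; exact: growth_ge0.
have mg : measurable_fun setT g.
  apply/(measurable_restrictT _ _).1 => //.
  exact: measurable_funS (sub_itv0t u0) measurable_growth.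
(* The indicator makes [q] act only after its own time, so that the strip
   below no longer depends on [s] and the integrals can be exchanged. *)
pose f (w : (R * R) * R) : \bar R :=
  (g w.2 * decay w.2 w.1.1 * (w.1.1 < w.2)%R%:R)%:E.
have f0 w : (0 <= f w)%E.
  by rewrite lee_fin !mulr_ge0// ltW// decay_gt0.
have m11 : measurable_fun setT (fun w : (R * R) * R => w.1.1).
  exact: measurableT_comp.
have mf : measurable_fun setT f.
  apply/measurable_EFinP; apply: measurable_funM.
    apply: measurable_funM; first exact: measurableT_comp.
    apply: measurable_funM => //; apply: measurableT_comp => //.
    by apply: measurable_funM => //; apply: measurable_funB.
  apply: measurableT_comp => //.
    exact: measurable_fun_ltr.
have [mK mG tonelli] := tonelli_restricted leb mS finS mf f0.
have -> : (\int[leb]_(s in `]u, t]) (growth s * (l' s - l s))%:E =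
   \int[leb]_(s in `]u, t]) ((growth s * decay s u)%:E +
      \int[m]_(q in strip `]u, t[ l l') f (q, s)))%E.
  apply: eq_integral => s /set_mem /= us.
  have gs : 0 <= growth s.
    by have /= := sub_itv0t u0 us; rewrite in_itv/=; exact: growth_ge0.
  rewrite EFinM (EFinB (l' s)) increment; last by move: us; rewrite in_itv.
  rewrite -(addeA (l s)%:E) addeAC subee// add0e muleDr//.
  congr (_ + _)%E.
  rewrite -ge0_integralZl_EFin//; last 3 first.
  - have -> : strip `]u, s[ l l' = strip `]u, t[ l l' `&` (`]-oo, s[ `*` [set: R]).
      apply/seteqP; split => -[r y] /=.
        move=> [/= + ry]; rewrite !in_itv/= => /andP[ur rs].
        split; last by split => //=; rewrite in_itv.
        split => //=; rewrite in_itv/= ur (lt_le_trans rs)//.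
        by move: us; rewrite in_itv/= => /andP[].
      move=> [[/= + ry] [+ _]]; rewrite !in_itv/= => /andP[ur _] rs.
      by split => //=; rewrite in_itv/= ur.
    by apply: measurableI => //; exact: measurableX.
  - by move=> q _; rewrite lee_fin ltW// decay_gt0.
  - exact: measurable_decay.
  rewrite integral_mkcond [RHS]integral_mkcond; congr integral.
  apply/funext => -[r y]; rewrite !patchE /f /=.
  have -> : g s = growth s by rewrite /g patchE mem_set.
  move: us; rewrite in_itv/= => /andP[us st].
  case: ifPn => [/set_mem [/= rs ry]|nS].
    move: rs; rewrite in_itv/= => /andP[ur rs].
    rewrite mem_set ?rs ?mulr1//; split => //=.
    by rewrite in_itv/= ur (lt_le_trans rs).
  case: ifPn => // /set_mem [/= rt ry].
  have -> : (r < s)%R = false; last by rewrite mulr0.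
  apply/negbTE/negP => rs; apply: (negP nS); apply/mem_set; split => //=.
  by move: rt; rewrite !in_itv/= => /andP[->].
rewrite ge0_integralD//; last 4 first.
- by move=> s us; rewrite lee_fin (growth_decay_ge0 _ u0).
- by apply/measurable_EFinP; exact: measurable_growth_decay.
- by move=> s _; exact: integral_ge0.
- exact: measurable_funTS.
rewrite compensatorE// leeD2l//.
have -> : (\int[leb]_(s in `]u, t]) \int[m]_(q in strip `]u, t[ l l') f (q, s) =
    \int[leb]_s \int[m]_(q in strip `]u, t[ l l') f (q, s))%E.
  rewrite integral_mkcond; congr integral; apply/funext => s; rewrite patchE.
  case: ifPn => // nus; apply/esym/integral0_eq => q _.
  by rewrite /f /= /g patchE (negbTE nus) !mul0r.
rewrite tonelli; apply: ge0_le_integral => //.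
- by move=> q _; exact: integral_ge0.
- exact: measurable_strip_jumps.
- move=> q [/=]; rewrite in_itv/= => /andP[uq qt] _.
  have q0t : 0 <= q.1 <= t by rewrite (ltW qt) (le_trans u0)// ltW.
  have -> : (\int[leb]_s f (q, s) =
      \int[leb]_(s in `]q.1, t]) (growth s * decay s q.1)%:E)%E.
    rewrite [RHS]integral_mkcond; congr integral; apply/funext => s.
    rewrite patchE /f /= /g patchE.
    case: ifPn => [/set_mem /=|nus]; case: ifPn => [/set_mem /=|nqs] //.
    - by rewrite in_itv/= => /andP[-> _]; rewrite mulr1.
    - rewrite in_itv/= => /andP[us st]; move: nqs; rewrite notin_setE/= in_itv/= st.
      by rewrite andbT => /negP/negbTE ->; rewrite mulr0.
    - rewrite in_itv/= => /andP[qs st]; move: nus.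
      by rewrite notin_setE/= in_itv/= st (lt_trans uq).
    - by rewrite !mul0r.
  by rewrite compensatorE// lee_fin gerBl F_ge0// uq ltW.
Qed.

End compensator.

(** * The lower bound for the Malliavin derivative *)

Section added_point_configuration.
Context (R : realType).
Implicit Types (m : {measure set (R * R) -> \bar R}) (q : R * R).

Lemma restr_past_add_point_lt m q s : q.1 < s ->
  restr_past (add_point m q) s = add_point (restr_past m s) q.
Proof.
move=> qs; apply: eq_measure; apply/funext => B.
rewrite /add_point [RHS]measure_addE /restr_past /mrestr /=.
rewrite [LHS]measure_addE; congr (_ + _)%E.
by rewrite [LHS]diracE [RHS]diracE in_setI [X in _ && X]mem_set ?andbT.
Qed.

Lemma restr_past_add_point_ge m q s : s <= q.1 ->
  restr_past (add_point m q) s = restr_past m s.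
Proof.
move=> sq; apply: eq_measure; apply/funext => B.
rewrite /add_point /restr_past /mrestr /= [LHS]measure_addE.
rewrite [X in (_ + X)%E]diracE memNset ?adde0// => -[_ []] /=.
by rewrite in_itv/= ltNge sq.
Qed.

End added_point_configuration.

Section malliavin_derivative.
Context (R : realType) (d : measure_display) (Omega : measurableType d).
Variables (N : Omega -> {measure set (R * R) -> \bar R}).
Variables (phi : R -> {measure set (R * R) -> \bar R} -> R).
Variables (lambda0 alpha beta T t u z : R) (J : R -> R) (w : Omega).
Hypotheses (alpha0 : 0 < alpha) (beta0 : 0 < beta) (lambda0_gt0 : 0 < lambda0).
Hypotheses (u0t : 0 <= u <= t) (tT : t <= T).
Hypothesis mJ : measurable_fun `[0, t] J.
Hypothesis J_ge0 : forall s, 0 <= s <= t -> 0 <= J s.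
Hypothesis J_nd : forall r s, 0 <= r -> r <= s -> s <= t -> J r <= J s.
Hypothesis heq : hawkes_equation lambda0 alpha beta T phi (N w).
Hypothesis heq_add :
  hawkes_equation lambda0 alpha beta T phi (add_point (N w) (u, z)).
Hypothesis zlu : 0 < z <= intensity N phi u w.
Local Notation decay := (decay alpha beta).
Local Notation leb := (@lebesgue_measure R).
Local Notation F := (F_fun J alpha beta t).
Hypothesis F_ge0 : forall v, u < v <= t -> 0 <= F v.

Let m := N w.
Let l s := phi s (restr_past m s).
Let l' s := phi s (restr_past (add_point m (u, z)) s).
Let hl : hawkes_path lambda0 alpha beta T m l. Proof. exact: heq. Qed.
Let hl' : hawkes_path lambda0 alpha beta T (add_point m (u, z)) l'.
Proof. exact: heq_add. Qed.
Let u0 : 0 <= u. Proof. by case/andP: u0t. Qed.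
Let ut : u <= t. Proof. by case/andP: u0t. Qed.

Let same_past r : r <= u -> l' r = l r.
Proof. by move=> ru; rewrite /l' /l restr_past_add_point_ge. Qed.

Let in_T s : u < s <= t -> u < s <= T.
Proof. by move=> /andP[-> st]; rewrite (le_trans st). Qed.

Lemma intensity_plusE s : u < s -> intensity_plus N phi u z s w = l' s.
Proof. by move=> us; rewrite /intensity_plus /l' restr_past_add_point_lt. Qed.

Lemma intensity_le_plus s : u < s <= t -> l s <= l' s.
Proof.
move=> /in_T; apply: (added_point_increases alpha0 beta0 lambda0_gt0 hl hl') => //.
Qed.

Lemma D_intensity_gt0 s : u < s <= t -> 0 < D_intensity N phi u z s w.
Proof.
move=> /[dup] ust /andP[us _]; rewrite /D_intensity intensity_plusE// subr_gt0.
rewrite -lte_fin.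
rewrite (added_point_increment alpha0 beta0 lambda0_gt0 hl hl' u0 zlu same_past
  (in_T ust)).
rewrite -addeA lteDl// (lt_le_trans _ (leeDl _ _))// ?lte_fin ?decay_gt0//.
by apply: integral_ge0 => q _; rewrite lee_fin ltW// decay_gt0.
Qed.

Let measurable_paths (s s' : bool) :
  measurable_fun [set` Interval (BSide s u) (BSide s' t)] l /\
  measurable_fun [set` Interval (BSide s u) (BSide s' t)] l'.
Proof.
have sub : [set` Interval (BSide s u) (BSide s' t)] `<=` `[0, T].
  move=> r rut; have [ur rt] : u <= r /\ r <= t.
    by move: rut; case: s; case: s'; rewrite /= in_itv/= => /andP[*];
      split => //; exact: ltW.
  by rewrite /= in_itv/= (le_trans u0)// (le_trans rt).
split; apply: measurable_funS sub _ => //.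
  exact: (measurable_hawkes_path alpha0 hl).
exact: (measurable_hawkes_path alpha0 hl').
Qed.

Let measurable_increment_strip (s s' : bool) :
  measurable (strip [set` Interval (BSide s u) (BSide s' t)] l l').
Proof.
have [ml ml'] := measurable_paths s s'.
exact: measurable_strip.
Qed.

(** The two paths being ordered after [u], [N_between] is on (u, t] the image under
[fst] of the configuration restricted to a measurable strip, hence a measure
there. *)
Lemma integral_N_between (f : R -> \bar R) :
  measurable_fun `]u, t] f -> (forall s, u < s <= t -> (0 <= f s)%E) ->
  (\int[N_between N phi u z w]_(s in `]u, t]) f s =
   \int[m]_(q in strip `]u, t] l l') f q.1)%E.
Proof.
move=> mf f0; have mS := measurable_increment_strip false false.
transitivity (\int[pushforward (mrestr m mS) fst]_(s in `]u, t]) f s)%E.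
  apply: eq_integral_set_function => // A mA Aut.
  rewrite /N_between /pushforward /mrestr; congr (m _).
  apply/seteqP; split => -[r y] /=.
    move=> [Ar]; have /= := Aut _ Ar; rewrite in_itv/= => /[dup] utr /andP[ur rt].
    have ll' := intensity_le_plus utr.
    by rewrite intensity_plusE// min_r// max_l//.
  move=> [Ar [/= + ry]]; rewrite in_itv/= => /[dup] utr /andP[ur rt].
  split => //; have ll' := intensity_le_plus utr.
  by rewrite intensity_plusE// min_r// max_l// in_itv.
rewrite ge0_integral_pushforward//; last first.
  by move=> s /set_mem /=; rewrite in_itv/=; exact: f0.
have mD : measurable (fst @^-1` `]u, t] : set (R * R)).
  by rewrite -[X in measurable X]setTI; apply: measurable_fst.
apply: integral_mrestr => //.
- by move=> q [].
- by move=> q /=; rewrite in_itv/=; exact: f0.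
- apply: (@measurable_comp _ _ _ _ _ _ `]u, t]) => //.
    by move=> _ [q qD <-].
  exact: measurable_funTS.
Qed.

(** The jump term gains at least [J v] for each point accepted because of the
added one at a time [v] before [t], which pays for its share of the compensator;
what is left is [J u] minus the share [J u - F u] of the added point itself. A
possibly infinite mass at the time [t] itself can only increase the jump
term. *)
Lemma F_le_D_log_price : ((F u)%:E <= D_log_price N phi J t u z w)%E.
Proof.
have mS := measurable_increment_strip false true.
have finS : (m (strip `]u, t[ l l') < +oo)%E.
  apply: (added_point_finite_strip alpha0 beta0 lambda0_gt0 hl hl' u0).
  by rewrite ut.
have incr s : u < s <= t -> ((l' s)%:E = (l s)%:E + (decay s u)%:E +
    \int[m]_(q in strip `]u, s[ l l') (decay s q.1)%:E)%E.
  move=> ust.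
  exact: (added_point_increment alpha0 beta0 lambda0_gt0 hl hl' u0 zlu same_past
    (in_T ust)).
have fin1 := strip_jumps_fin_num mJ J_ge0 J_nd u0t mS finS.
have le2 := compensator_le alpha0 beta0 mJ J_ge0 J_nd u0t mS finS incr F_ge0.
rewrite /D_log_price indicE mem_set/= ?in_itv// mulr1.
set I1 := integral (N_between _ _ _ _ _) _ _.
set I2 := integral leb _ _.
set I0 := integral m _ _ in fin1 le2.
have leI2 : (I2 <= (J u - F u)%:E + I0)%E.
  have -> // : I2 =
      (\int[leb]_(s in `]u, t]) (growth J s * (l' s - l s))%:E)%E.
  rewrite /I2; apply: eq_integral_set_function => // s /=.
  rewrite in_itv/= => /andP[us _].
  by rewrite /D_intensity intensity_plusE.
have leI1 : (I0 <= I1)%E.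
  have -> : I1 = (\int[N_between N phi u z w]_(s in `]u, t]) (J s)%:E)%E.
    rewrite /I1; apply: eq_integral_set_function => // s /=; rewrite in_itv/= => ust.
    by rewrite gtr0_sg ?mulr1// D_intensity_gt0.
  have Jpos s : u < s <= t -> (0 <= (J s)%:E)%E.
    by move=> /andP[/ltW us st]; rewrite lee_fin J_ge0// (le_trans u0).
  rewrite integral_N_between//; last first.
    by apply/measurable_EFinP; exact: measurable_funS (sub_itv0t u0) mJ.
  apply: ge0_subset_integral => //.
  - apply/measurable_EFinP; apply: (@measurable_comp _ _ _ _ _ _ `[0, t]) => //.
    + by move=> _ [q [qD _] <-]; exact: sub_itv0t u0 _ qD.
    + exact: measurable_funTS.
  - by move=> q [/=]; rewrite in_itv/= => /Jpos.
  - move=> q [/=]; rewrite in_itv/= => /andP[uq /ltW qt] lq; split => //=.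
    by rewrite in_itv/= uq.
apply: (@le_trans _ _ ((J u)%:E + I0 - ((J u - F u)%:E + I0))%E).
  move: fin1; case: I0 {le2 leI1 leI2} => // r _.
  by rewrite -!EFinD lee_fin le_eqVlt; apply/orP; left; apply/eqP; ring.
by apply: leeB => //; exact: leeD2l.
Qed.

End malliavin_derivative.

(** * Negative moments of the Malliavin derivative *)

Theorem lemma3p6 (R : realType) (d : measure_display)
    (Omega : measurableType d) (P : probability Omega R)
    (T t lambda0 alpha beta mu sigma : R)
    (N : Omega -> {measure set (R * R) -> \bar R})
    (W : R -> Omega -> R)
    (phi : R -> {measure set (R * R) -> \bar R} -> R)
    (J : R -> R) (X : R -> Omega -> R) (v0 v1 : R)
    (hT : 0 < T) (ht : 0 < t <= T)
    (hlambda0 : 0 < lambda0) (halpha : 0 < alpha) (hbeta : 0 < beta)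
    (hab : alpha / beta < 1) (hsigma : 0 < sigma)
    (hN : is_poisson_random_measure P (@mean_measure R) N)
    (hW : is_brownian_motion P W)
    (hWN : independent_sigma P (sigma_process W) (sigma_random_measure N))
    (hphi : is_hawkes_functional P N lambda0 alpha beta T phi)
    (hJmeas : measurable_fun `[0, T] J)
    (hJint : forall q : R, 1 <= q ->
      (\int[@lebesgue_measure R]_(s in `[0%R, T])
         ((expR (J s) - 1) `^ (2 * q))%:E < +oo)%E)
    (hJge0 : forall s, 0 <= s <= T -> 0 <= J s)
    (hJincr : forall r s, 0 <= r -> r < s -> s <= T -> J r < J s)
    (hJ0 : J 0 = 0)
    (hX : forall s, 0 <= s <= T ->
      {ae P, forall w, (X s w)%:E = log_price N phi J mu sigma W s w})
    (hv0 : unique (fun v => 0 <= v <= t /\ G_fun J beta t v = 0) v0)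
    (hv1 : v0 <= v1 <= t)
    (hFincr : forall v v', v1 <= v -> v <= v' -> v' <= t ->
      F_fun J alpha beta t v <= F_fun J alpha beta t v')
    (hFpos : forall v, v1 <= v <= t -> 0 < F_fun J alpha beta t v) :
  forall p : R, 1 <= p ->
  forall u z : R, 0 <= u <= t -> 0 <= z -> v1 < u ->
    (0 < P [set w | (z < intensity N phi u w)%R])%E ->
    (\int[P]_w ((\1_(`]0%R, intensity N phi u w]) z)%:E /
                (`| D_log_price N phi J t u z w | `^ p)) < +oo)%E.
Proof.
move=> p p1 u z u0t z0 v1u _.
have p0 : 0 <= p by exact: le_trans p1.
have /andP[u0 ut] := u0t; have /andP[_ tT] := ht.
have uT : 0 <= u <= T by rewrite u0 (le_trans ut).
have Fu : 0 < F_fun J alpha beta t u by apply: hFpos; rewrite ltW.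
case: hphi => heq heq_add _.
apply: (@le_lt_trans _ _ ((F_fun J alpha beta t u `^ p)^-1)%:E); last first.
  exact: ltry.
apply: integral_ae_le_cst.
- by rewrite invr_ge0 powR_ge0.
- by move=> w; rewrite mule_ge0 ?lee_fin// inve_ge0 poweR_ge0.
apply: filterS2 heq (heq_add _ _ uT z0) => w hw hw_add.
rewrite indicE; have [/set_mem|_] := boolP (z \in _); last first.
  by rewrite mul0e lee_fin invr_ge0 powR_ge0.
rewrite /= in_itv/= mul1e => zlu.
have le_D : ((F_fun J alpha beta t u)%:E <= D_log_price N phi J t u z w)%E.
  apply: (F_le_D_log_price halpha hbeta hlambda0 u0t tT _ _ _ hw hw_add zlu).
  - apply: measurable_funS hJmeas => // s /=; rewrite !in_itv/= => /andP[-> st].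
    exact: le_trans tT.
  - by move=> s /andP[s0 st]; rewrite hJge0// s0 (le_trans st).
  - move=> r s r0; rewrite le_eqVlt => /predU1P[->//|rs] st.
    by rewrite ltW// hJincr// (le_trans st).
  - by move=> v /andP[uv vt]; rewrite ltW// hFpos// vt ltW// (lt_trans v1u).
have Fp : (0 < F_fun J alpha beta t u `^ p)%R by rewrite powR_gt0.
have -> : (((F_fun J alpha beta t u `^ p)^-1)%:E =
    ((F_fun J alpha beta t u)%:E `^ p)^-1 :> \bar R)%E.
  by rewrite poweR_EFin inver gt_eqF.
rewrite lee_pV2 ?inE ?poweR_ge0//.
apply: gt0_ler_poweR => //.
- by rewrite in_itv/= lee_fin leey ltW.
- by rewrite in_itv/= abse_ge0 leey.
- exact: le_trans le_D (lee_abs _).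
Qed.
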